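(* Let $\mu$ be the uniform probability measure on $\{-1,1\}^n$. There exists a universal constant $\kappa>0$ such that for every continuously differentiable $f:\mathbb{R}^n\to\mathbb{R}$, $$\log\int e^f\,d\mu\le\sup_{y\in[-1,1]^n}\{f(y)-I(y)\}+\kappa\, b(V),$$ where $V=\nabla f([-1,1]^n)$.
   Context: $I(x)=\sum_{i=1}^n\big(\frac{1+x_i}{2}\log(1+x_i)+\frac{1-x_i}{2}\log(1-x_i)\big)$ for $x\in[-1,1]^n$ and $+\infty$ otherwise (equivalently $I(y)=H(\mu_y|\mu)$ where $\mu_y$ is the product measure on $\{-1,1\}^n$ with mean $y$). $b(V)=\mathbb{E}\sup_{\xi\in V}\langle\xi,\varepsilon\rangle$ with $\varepsilon$ uniform on $\{-1,1\}^n$. *)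

(* Defs.v *)
From HB Require Import structures.
From mathcomp Require Import all_boot all_order all_algebra.
From mathcomp Require Import all_classical all_reals all_analysis.
From mathcomp Require Import Rstruct Rstruct_topology.
Set Implicit Arguments. Unset Strict Implicit. Unset Printing Implicit Defensive.
Import Order.TTheory GRing.Theory Num.Theory.
Import numFieldNormedType.Exports.
Local Open Scope ring_scope.
Local Open Scope classical_set_scope.

Definition RR : realType := Rdefinitions.R.

Definition sgn_vec n (e : {ffun 'I_n -> bool}) : 'rV[RR]_n :=
  \row_i (if e i then 1 else -1).

Definition cube n : set 'rV[RR]_n := [set y | forall i, -1 <= y 0 i <= 1].

(* I(y) = sum_i ((1+y_i)/2 log(1+y_i) + (1-y_i)/2 log(1-y_i)), used on [-1,1]^n
   (convention 0 log 0 = 0 holds automatically since the factor is 0). *)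
Definition Ifun n (y : 'rV[RR]_n) : RR :=
  \sum_i ((1 + y 0 i) / 2 * ln (1 + y 0 i) + (1 - y 0 i) / 2 * ln (1 - y 0 i)).

Definition grad n (f : 'rV[RR]_n -> RR) (y : 'rV[RR]_n) : 'rV[RR]_n :=
  \row_i ('d f y (delta_mx 0 i)).

Definition dot n (u v : 'rV[RR]_n) : RR := \sum_i u 0 i * v 0 i.

Definition unif_mean n (g : 'rV[RR]_n -> RR) : RR :=
  (2 ^+ n)^-1 * \sum_(e : {ffun 'I_n -> bool}) g (sgn_vec e).

Definition bfun n (V : set 'rV[RR]_n) : RR :=
  unif_mean (fun eps => sup [set dot xi eps | xi in V]).

(* Main.v *)
Require Import Defs.
From HB Require Import structures.
From mathcomp Require Import all_boot all_order all_algebra.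
From mathcomp Require Import all_classical all_reals all_analysis.
From mathcomp Require Import Rstruct Rstruct_topology.
From mathcomp Require Import ring lra.
Import Order.TTheory GRing.Theory Num.Theory.
Import numFieldNormedType.Exports.
Local Open Scope ring_scope.
Local Open Scope classical_set_scope.

(* By the mean value theorem f(x) <= f(y) + S(x - y) for signs x and y in the
   cube, where S(u) = sup_(xi in V) <xi, u> is convex.  Reveal the coordinates
   of X ~ e^f dmu / Z one at a time and put Y_i = E[X_i | X_1, ..., X_(i-1)]:
   by the chain rule the entropy of X relative to mu is E I(Y), so that
   log Z <= sup (f - I) + E S(X - Y).  The X_i - Y_i are martingale differences
   bounded by 2, and given the past a centered variable in [-2, 2] is dominated
   in convex order by 2 times a random sign; hence E S(X - Y) <= E S(2 eps),
   and kappa = 2.  Induction on the dimension replaces the martingale below. *)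

(** This is the Gibbs variational formula on two points, at its optimum: the weights [(1 + t) / 2]
    and [(1 - t) / 2] are proportional to [expR a] and [expR b]. With [Z] the mean of these
    exponentials, [ln (1 + t) = a - ln Z] and [ln (1 - t) = b - ln Z], which makes it an
    equality. *)
Lemma ln_mean_expR (R : realType) (a b : R) :
  exists2 t : R, -1 <= t <= 1 &
    ln ((expR a + expR b) / 2) = (1 + t) / 2 * a + (1 - t) / 2 * b
      - ((1 + t) / 2 * ln (1 + t) + (1 - t) / 2 * ln (1 - t)).
Proof.
pose Z := (expR a + expR b) / 2.
have a0 := expR_gt0 a; have b0 := expR_gt0 b.
have Z0 : 0 < Z by rewrite /Z; lra.
pose t := (expR a - Z) / Z.
have tE : 1 + t = expR a / Z by rewrite /t; field; rewrite gt_eqF.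
have tE' : 1 - t = expR b / Z.
  have -> : expR b = 2 * Z - expR a by rewrite /Z; field.
  by rewrite /t; field; rewrite gt_eqF.
have t1 : 0 <= 1 + t by rewrite tE divr_ge0 ?ltW.
have t2 : 0 <= 1 - t by rewrite tE' divr_ge0 ?ltW.
exists t; first by apply/andP; split; lra.
rewrite -/Z.
have -> : ln (1 + t) = a - ln Z by rewrite tE ln_div ?posrE // expRK.
have -> : ln (1 - t) = b - ln Z by rewrite tE' ln_div ?posrE // expRK.
by field.
Qed.

(** * Splitting off the first coordinate *)

Lemma sgn_row n (e : {ffun 'I_(1 + n) -> bool}) :
  sgn_vec e = row_mx (if e (lshift n ord0) then 1 else -1)%:M
                     (sgn_vec [ffun i => e (rshift 1 i)]).
Proof.
apply/rowP => i; rewrite mxE; case: (split_ordP i) => j ->.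
  by rewrite row_mxEl mxE ord1 eqxx mulr1n.
by rewrite row_mxEr mxE ffunE.
Qed.

Lemma unif_mean_recl n (g : 'rV[RR]_(1 + n) -> RR) :
  unif_mean g = (unif_mean (fun u => g (row_mx 1%:M u)) +
                 unif_mean (fun u => g (row_mx (-1)%:M u))) / 2.
Proof.
rewrite /unif_mean -mulrDr exprD expr1 invfM -[RHS]mulrC -!mulrA; congr (_ * (_ * _)).
pose h (p : bool * {ffun 'I_n -> bool}) : {ffun 'I_(1 + n) -> bool} :=
  [ffun i => match fintype.split i with inl _ => p.1 | inr j => p.2 j end].
pose h' (e : {ffun 'I_(1 + n) -> bool}) := (e (lshift n ord0), [ffun i => e (rshift 1 i)]).
have hl p : h p (lshift n ord0) = p.1 by rewrite ffunE (unsplitK (inl _)).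
have hr p j : h p (rshift 1 j) = p.2 j by rewrite ffunE (unsplitK (inr _)).
have hK : cancel h h'.
  by case=> b e; rewrite /h' hl; congr (_, _); apply/ffunP => j; rewrite ffunE hr.
have h'K : cancel h' h.
  move=> e; apply/ffunP => i; case: (split_ordP i) => j ->; last by rewrite hr ffunE.
  by rewrite ord1 hl.
rewrite (reindex h); last by exists h' => x _; [exact: hK | exact: h'K].
rewrite -(pair_bigA _ (fun b e => g (sgn_vec (h (b, e))))) /= big_bool /=.
by congr (_ + _); apply: eq_bigr => e _; rewrite sgn_row hl; congr (g (row_mx _ (sgn_vec _)));
  apply/ffunP => j; rewrite ffunE hr.
Qed.

Lemma Ifun_row_mx m n (u : 'rV[RR]_m) (v : 'rV[RR]_n) :
  Ifun (row_mx u v) = Ifun u + Ifun v.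
Proof.
rewrite /Ifun big_split_ord /=.
by congr (_ + _); apply: eq_bigr => i _; rewrite ?row_mxEl ?row_mxEr.
Qed.

Lemma cube_row_mx n (t : RR) (u : 'rV[RR]_n) : -1 <= t <= 1 -> cube u ->
  cube (row_mx t%:M u : 'rV[RR]_(1 + n)).
Proof.
move=> t1 cu i; case: (split_ordP i) => j ->; last by rewrite row_mxEr.
by rewrite row_mxEl mxE !ord1 eqxx mulr1n.
Qed.

Lemma ler_unif_mean n (g h : 'rV[RR]_n -> RR) :
  (forall e, g (sgn_vec e) <= h (sgn_vec e)) -> unif_mean g <= unif_mean h.
Proof.
move=> gh; rewrite /unif_mean ler_wpM2l ?invr_ge0 ?exprn_ge0 //.
by apply: ler_sum => e _; exact: gh.
Qed.

Lemma unif_mean_linear n (g h : 'rV[RR]_n -> RR) (a b : RR) :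
  unif_mean (fun x => a * g x + b * h x) = a * unif_mean g + b * unif_mean h.
Proof. by rewrite /unif_mean big_split /= -!mulr_sumr; ring. Qed.

Lemma unif_mean_expR_gt0 n (g : 'rV[RR]_n -> RR) :
  0 < unif_mean (fun x => expR (g x)).
Proof.
rewrite /unif_mean mulr_gt0 ?invr_gt0 ?exprn_gt0 //.
rewrite (bigD1 [ffun=> true]) //= ltr_pwDl ?expR_gt0 ?sumr_ge0 //.
Qed.

(** * Induction on the dimension *)

Definition convex_rV {n : nat} (S : 'rV[RR]_n -> RR) := forall (l : RR) u v,
  0 <= l <= 1 -> S (l *: u + (1 - l) *: v) <= l * S u + (1 - l) * S v.

(** Only convexity of [S] is kept from the support function, since freezing a first coordinate
    preserves it but destroys homogeneity. Likewise [M] is arbitrary so that it can absorb the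
    entropy of that coordinate. *)
Lemma ln_unif_mean_le n (f S : 'rV[RR]_n -> RR) (M : RR) : convex_rV S ->
  (forall e y, cube y -> f (sgn_vec e) <= M + Ifun y + S (sgn_vec e - y)) ->
  ln (unif_mean (fun x => expR (f x))) <= M + unif_mean (fun x => S (2 *: x)).
Proof.
elim: n f S M => [|n IHn] f S M Sconv fS.
  (* In dimension 0 there is a single sign vector, and the claim is the hypothesis at [y = 0]. *)
  have one (g : 'rV[RR]_0 -> RR) : unif_mean g = g 0.
    rewrite /unif_mean expr0 invr1 mul1r (bigD1 [ffun=> true]) //= big1 ?addr0.
      by congr g; apply/rowP; case.
    by move=> e /eqP[]; apply/ffunP; case.
  rewrite !one expRK scaler0.
  have := fS [ffun=> true] 0; rewrite /Ifun big_ord0 addr0 subr0.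
  have -> : sgn_vec [ffun=> true] = 0 :> 'rV_0 by apply/rowP; case.
  by apply; case.
rewrite -[n.+1]/(1 + n)%N in f S Sconv fS *.
(* In [G] the increments of the later coordinates are already replaced by doubled signs; the first
   one is still free. *)
pose G (t : RR) := unif_mean (fun u : 'rV[RR]_n => S (row_mx t%:M (2 *: u))).
have row_conv (l a b : RR) (u v : 'rV[RR]_n) :
    row_mx (l * a + (1 - l) * b)%:M (l *: u + (1 - l) *: v) =
    l *: row_mx a%:M u + (1 - l) *: row_mx b%:M v.
  by rewrite !scale_row_mx add_row_mx !scale_scalar_mx -raddfD.
have Gconv l a b : 0 <= l <= 1 -> G (l * a + (1 - l) * b) <= l * G a + (1 - l) * G b.
  move=> l01; rewrite -unif_mean_linear; apply: ler_unif_mean => e.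
  by apply: le_trans (Sconv _ _ _ l01); rewrite -row_conv -scalerDl [l + (1 - l)]addrC subrK scale1r.
(* The first coordinates of the sign vector and of [y] are frozen at the sign [b] and at [t]. Since
   [t] is the same for both signs, it can be chosen afterwards. *)
have step (b : bool) (t : RR) : -1 <= t <= 1 ->
    ln (unif_mean (fun u : 'rV[RR]_n => expR (f (row_mx (if b then 1 else -1)%:M u)))) <=
    M + Ifun (t%:M : 'rV[RR]_1) + G ((if b then 1 else -1) - t).
  move=> t1; pose c : RR := if b then 1 else -1; rewrite -/c.
  apply: (IHn (fun u => f (row_mx c%:M u)) (fun u => S (row_mx (c - t)%:M u))) =>
    [l u v l01|e y cy].
    apply: le_trans (Sconv _ _ _ l01); rewrite -row_conv.
    by have -> : l * (c - t) + (1 - l) * (c - t) = c - t by ring.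
  pose e' : {ffun 'I_(1 + n) -> bool} :=
    [ffun i => match fintype.split i with inl _ => b | inr j => e j end].
  have := fS e' (row_mx t%:M y) (cube_row_mx _ _ _ t1 cy).
  rewrite sgn_row Ifun_row_mx opp_row_mx add_row_mx -raddfB.
  have -> : e' (lshift n ord0) = b by rewrite ffunE (unsplitK (inl _)).
  have -> : [ffun i => e' (rshift 1 i)] = e.
    by apply/ffunP => j; rewrite !ffunE (unsplitK (inr _)).
  by rewrite addrA.
rewrite !unif_mean_recl.
set A := unif_mean (fun u => expR (f (row_mx 1%:M u))).
set B := unif_mean (fun u => expR (f (row_mx (-1)%:M u))).
(* [t] is the mean of the first coordinate under the Gibbs measure. *)
have [t t1] := ln_mean_expR _ (ln A) (ln B).
rewrite !lnK ?posrE ?unif_mean_expR_gt0 // => ->.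
have /andP[tl tr] := t1.
have It : Ifun (t%:M : 'rV[RR]_1) =
    (1 + t) / 2 * ln (1 + t) + (1 - t) / 2 * ln (1 - t).
  by rewrite /Ifun big_ord1 mxE eqxx mulr1n.
have hA := step true t t1; have hB := step false t t1.
rewrite /= -/A It in hA; rewrite /= -/B It in hB.
have GE b : unif_mean (fun u : 'rV[RR]_n => S (2 *: row_mx b%:M u)) = G (2 * b).
  by congr unif_mean; apply/funext => u; rewrite scale_row_mx scale_scalar_mx.
rewrite !GE mulr1 mulrN1.
(* Both increments [1 - t] and [-1 - t] lie in [-2, 2], so convexity bounds [G] there by its chord
   between -2 and 2. *)
have g1 : G (1 - t) <= (3 - t) / 4 * G 2 + (1 + t) / 4 * G (-2).
  have := Gconv ((3 - t) / 4) 2 (-2).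
  have -> : (3 - t) / 4 * 2 + (1 - (3 - t) / 4) * (-2) = 1 - t by field.
  have -> : 1 - (3 - t) / 4 = (1 + t) / 4 by field.
  by apply; apply/andP; split; lra.
have g2 : G (-1 - t) <= (1 - t) / 4 * G 2 + (3 + t) / 4 * G (-2).
  have := Gconv ((1 - t) / 4) 2 (-2).
  have -> : (1 - t) / 4 * 2 + (1 - (1 - t) / 4) * (-2) = -1 - t by field.
  have -> : 1 - (1 - t) / 4 = (3 + t) / 4 by field.
  by apply; apply/andP; split; lra.
have p0 : 0 <= (1 + t) / 2 by lra.
have q0 : 0 <= (1 - t) / 2 by lra.
(* Under the weights [(1 + t) / 2] and [(1 - t) / 2] the increment has mean zero, so [G 2] and
   [G (-2)] each get total weight 1/2; the entropy of [t] cancels. *)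
have := ler_wpM2l p0 (le_trans hA (lerD (lexx _) g1)).
have := ler_wpM2l q0 (le_trans hB (lerD (lexx _) g2)).
lra.
Qed.

(** * Bounds on the cube, making the suprema finite *)

Lemma ge_subr1_mulr_ln (x : RR) : 0 <= x -> x - 1 <= x * ln x.
Proof.
rewrite le_eqVlt => /predU1P[<-|x0]; first by rewrite mul0r; lra.
have := @le_ln1Dx RR (x^-1 - 1); rewrite [1 + _]addrC subrK lnV ?posrE // => h.
have {}h : - ln x <= x^-1 - 1 by apply: h; rewrite ltrBrDl subrr invr_gt0.
have := ler_wpM2l (ltW x0) h; rewrite mulrBr divff ?gt_eqF //; lra.
Qed.

(** The tangent-line bounds for x log x at [1 + y 0 i] and [1 - y 0 i] are opposite and cancel. *)
Lemma Ifun_ge0 n (y : 'rV[RR]_n) : cube y -> 0 <= Ifun y.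
Proof.
move=> cy; apply: sumr_ge0 => i _; have /andP[yl yr] := cy i.
have h1 : 0 <= 1 + y 0 i by lra.
have h2 : 0 <= 1 - y 0 i by lra.
have := ge_subr1_mulr_ln _ h1; have := ge_subr1_mulr_ln _ h2; lra.
Qed.

Lemma compact_cube n : compact (@cube n).
Proof.
have -> : @cube n = [set v | forall i, `[-1, 1]%classic (v ord0 i)].
  by apply/seteqP; split => v /= cv i; move: (cv i); rewrite /= in_itv.
exact: (@rV_compact RR n (fun=> `[-1, 1]%classic) (fun=> @segment_compact _ _ _)).
Qed.

Lemma cube0 n : cube (0 : 'rV[RR]_n).
Proof. by move=> i; rewrite mxE; apply/andP; split; lra. Qed.

Lemma cube_sgn_vec n (e : {ffun 'I_n -> bool}) : cube (sgn_vec e).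
Proof. by move=> i; rewrite mxE; case: (e i); apply/andP; split; lra. Qed.

Lemma cube_has_ubound n (g : 'rV[RR]_n -> RR) : continuous g ->
  has_ubound (g @` @cube n).
Proof.
move=> cg; suff [] : has_sup (g @` @cube n) by [].
apply: compact_has_sup; first by exists (g 0), 0 => //; exact: cube0.
by apply: continuous_compact; [exact: continuous_subspaceT | exact: compact_cube].
Qed.

(** * Gradients and the mean value theorem *)

Lemma continuous_dot n (F : 'rV[RR]_n -> 'rV[RR]_n) (u : 'rV[RR]_n) :
  continuous F -> continuous (fun y => dot (F y) u).
Proof.
move=> cF; apply: continuous_big => [|i _ y]; first exact: add_continuous.
apply: cvgMr_tmp; first exact: nbhs_filter.
exact: (cvg_comp _ _ (cF y) (@coord_continuous RR 1 n 0 i (F y))).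
Qed.

Lemma diff_dot n (f : 'rV[RR]_n -> RR) (y h : 'rV[RR]_n) :
  differentiable f y -> 'd f y h = dot (grad f y) h.
Proof.
move=> fy; rewrite {1}[h]row_sum_delta linear_sum; apply: eq_bigr => i _.
by rewrite linearZ mxE mulrC.
Qed.

Lemma MVT_grad n (f : 'rV[RR]_n -> RR) (x y : 'rV[RR]_n) :
  (forall z, differentiable f z) -> cube x -> cube y ->
  exists2 z, cube z & f x - f y = dot (grad f z) (x - y).
Proof.
(* The one-variable theorem is applied along the segment from [y] to [x], which stays in the cube by
   convexity. *)
move=> df cx cy; pose p (t : RR) : 'rV[RR]_n := y + t *: (x - y).
have dp (t : RR) : is_derive t 1 (f \o p) (dot (grad f (p t)) (x - y)).
  have dpt : is_diff t p (0 + *:%R^~ (x - y)) by exact: is_diffD.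
  have dft : differentiable (f \o p) t by apply: differentiable_comp.
  apply: DeriveDef; first exact/derivable1_diffP.
  by rewrite deriveE // diff_comp //= diff_val /= add0r scale1r diff_dot.
have [] := @MVT RR (f \o p) (fun t => dot (grad f (p t)) (x - y)) 0 1 ltr01.
  by apply: derivable_within_continuous => t _; have [] := dp t.
move=> c; rewrite in_itv /= => /andP[c0 c1]; rewrite /p /= scale1r scale0r addr0 subr0 mulr1.
rewrite [y + _]addrC subrK => E; exists (p c); last by rewrite E.
move=> i; rewrite !mxE; have /andP[? ?] := cx i; have /andP[? ?] := cy i.
by apply/andP; split; nra.
Qed.

Lemma dotDr n (u v w : 'rV[RR]_n) : dot u (v + w) = dot u v + dot u w.
Proof. by rewrite /dot -big_split; apply: eq_bigr => i _; rewrite mxE mulrDr. Qed.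

Lemma dotZr n (a : RR) (u v : 'rV[RR]_n) : dot u (a *: v) = a * dot u v.
Proof. by rewrite /dot mulr_sumr; apply: eq_bigr => i _; rewrite mxE mulrCA. Qed.

Theorem theorem2p6 :
  exists kappa : RR, 0 < kappa /\
    forall (n : nat) (f : 'rV[RR]_n -> RR),
      (forall y, differentiable f y) -> continuous (grad f) ->
      ln (unif_mean (fun x => expR (f x)))
        <= sup [set f y - Ifun y | y in @cube n] + kappa * bfun (grad f @` @cube n).
Proof.
exists 2; split => // n f df cgrad.
set V := grad f @` _; set M := sup _.
pose S (u : 'rV[RR]_n) : RR := sup [set dot xi u | xi in V].
have V0 u : [set dot xi u | xi in V] !=set0.
  by exists (dot (grad f 0) u), (grad f 0) => //; exists 0 => //; exact: cube0.
have leS z u : cube z -> dot (grad f z) u <= S u.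
  move=> cz; apply: ub_le_sup; last by exists (grad f z) => //; exists z.
  rewrite image_comp.
  exact: cube_has_ubound (continuous_dot _ _ u cgrad).
have Sle u c : (forall z, cube z -> dot (grad f z) u <= c) -> S u <= c.
  by move=> h; apply: ge_sup => // _ [_ [z cz <-] <-]; exact: h.
have Sconv : convex_rV S.
  move=> l u v /andP[l0 l1]; apply: Sle => z cz.
  rewrite dotDr !dotZr lerD // ler_wpM2l ?leS //; lra.
have fM y : cube y -> f y - Ifun y <= M.
  (* Boundedness has to be checked, as [sup] is a default value on unbounded sets; it follows from
     [f] being bounded on the cube and the entropy being nonnegative. *)
  move=> cy; apply: ub_le_sup; last by exists y.
  have [B fB] : has_ubound (f @` @cube n).
    by apply: cube_has_ubound => y'; exact: differentiable_continuous.
  exists B => _ [z cz <-]; have := Ifun_ge0 _ _ cz.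
  have : f z <= B by apply: fB; exists z.
  lra.
have : ln (unif_mean (fun x => expR (f x))) <= M + unif_mean (fun x => S (2 *: x)).
  apply: ln_unif_mean_le => // e y cy.
  have [z cz] := MVT_grad _ _ _ _ df (cube_sgn_vec _ e) cy.
  have := leS z (sgn_vec e - y) cz; have := fM y cy; lra.
move/le_trans; apply; rewrite lerD2l.
(* The null second term only fits the two-function form of [unif_mean_linear]. *)
have -> : 2 * bfun V = unif_mean (fun u => 2 * S u + 0 * S u).
  by rewrite unif_mean_linear mul0r addr0.
apply: ler_unif_mean => e; rewrite mul0r addr0; apply: Sle => z cz.
by rewrite dotZr ler_wpM2l ?leS.
Qed.
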